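(* Let $k\geq 1$. For every $\sigma\in\mathfrak{S}_{2k}$ there exist $\tau,\tau_1\in K$ and $g,g_1\in\mathfrak{S}_k$ such that (i) $\sigma\tau\overline{g}\sigma^{-1}=\tau_1\overline{g_1}$, and (ii) $\mathrm{sgn}(\tau_1)\,\mathrm{sgn}(g)\,\mathrm{sgn}(g_1)=-1$.
   Context: $\mathfrak{S}_r$ denotes the symmetric group on $\{1,\dots,r\}$ and $\mathrm{sgn}$ the sign of a permutation. $K$ is the subgroup of $\mathfrak{S}_{2k}$ generated by the transpositions $(1\,2),(3\,4),\dots,(2k-1\;2k)$. For $g\in\mathfrak{S}_k$, $\overline{g}\in\mathfrak{S}_{2k}$ is defined by $\overline{g}(2s-1)=2g(s)-1$ and $\overline{g}(2s)=2g(s)$ for $s=1,\dots,k$. In (ii), $\mathrm{sgn}(\tau_1)$ is the sign in $\mathfrak{S}_{2k}$ and $\mathrm{sgn}(g),\mathrm{sgn}(g_1)$ are the signs in $\mathfrak{S}_k$. *)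

(* Defs.v *)
From mathcomp Require Import all_boot all_order all_algebra all_fingroup.
From mathcomp Require Import zify.

Set Implicit Arguments.
Unset Strict Implicit.
Unset Printing Implicit Defensive.

(* The set {1, ..., r} is modelled by 'I_r = {0, ..., r - 1}, the integer i
   corresponding to the ordinal i - 1. Hence for s in {1, ..., k}, represented
   by the ordinal s : 'I_k, the points 2s-1 and 2s of {1, ..., 2k} are
   represented by the ordinals of value 2 * s and 2 * s + 1. *)

Fact pt_subproof (k : nat) (s : 'I_k) (b : bool) : 2 * s + b < 2 * k.
Proof. by case: b; have := ltn_ord s; lia. Qed.

Definition pt (k : nat) (s : 'I_k) (b : bool) : 'I_(2 * k) :=
  Ordinal (pt_subproof s b).

Fact blk_subproof (k : nat) (x : 'I_(2 * k)) : x./2 < k.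
Proof. by have := ltn_ord x; lia. Qed.

Definition blk (k : nat) (x : 'I_(2 * k)) : 'I_k := Ordinal (blk_subproof x).

Lemma blk_pt (k : nat) (s : 'I_k) (b : bool) : blk (pt s b) = s.
Proof. by apply: val_inj; case: b => /=; lia. Qed.

Lemma odd_pt (k : nat) (s : 'I_k) (b : bool) : odd (pt s b) = b.
Proof. by case: b => /=; lia. Qed.

Lemma pt_blk (k : nat) (x : 'I_(2 * k)) : pt (blk x) (odd x) = x.
Proof. by apply: val_inj => /=; lia. Qed.

Definition subgroupK (k : nat) : {group 'S_(2 * k)} :=
  <<[set tperm (pt s false) (pt s true) | s : 'I_k]>>%G.

Definition bar_fun (k : nat) (g : 'S_k) (x : 'I_(2 * k)) : 'I_(2 * k) :=
  pt (g (blk x)) (odd x).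

Fact bar_fun_inj (k : nat) (g : 'S_k) : injective (bar_fun g).
Proof.
move=> x y e; rewrite -(pt_blk x) -(pt_blk y).
have := congr1 (@blk k) e; rewrite /bar_fun !blk_pt => /perm_inj ->.
have := congr1 (fun z : 'I_(2 * k) => odd z) e.
by rewrite /bar_fun !odd_pt => ->.
Qed.

Definition bar (k : nat) (g : 'S_k) : 'S_(2 * k) := perm (@bar_fun_inj k g).

(* b = false: bar g (2s-1) = 2 g(s) - 1;  b = true: bar g (2s) = 2 g(s). *)
Lemma bar_pt (k : nat) (g : 'S_k) (s : 'I_k) (b : bool) :
  bar g (pt s b) = pt (g s) b.
Proof. by rewrite permE /bar_fun blk_pt odd_pt. Qed.

Definition sgn (r : nat) (s : 'S_r) : int := ((-1) ^+ odd_perm s)%R.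

(* Main.v *)
Require Import Defs.
From mathcomp Require Import all_boot all_order all_algebra all_fingroup.
From mathcomp Require Import zify.

(** [M0] is the perfect matching of the points [2s-1, 2s], and [M1] is its
    image under [sigma].  A permutation is of the form [tau1 * bar g1] iff it
    preserves [M0], with [g1] the induced permutation of the edges, and [bar g1]
    is even.  So one needs a permutation [r] preserving [M0] and [M1] for which
    the signs of its actions on points, on [M0] and on [M1] multiply to [-1].
    The union of [M0] and [M1] is a disjoint union of alternating cycles.  Take
    for [r] the reflection of one of them, with [l] edges of each matching,
    through the midpoint of an edge: it exchanges [l] pairs of points and fixes
    exactly two edges, hence exchanges [l - 1] pairs of edges. *)

(** Peel off the outer pair: its transposition times the reversal of the inner points, hence [n./2]
    disjoint transpositions in all. It serves for the points of a cycle and for the edges of either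
    matching. *)
Lemma reversal_perm (T : finType) (n : nat) (v : nat -> T) :
    {in gtn n &, injective v} ->
  exists p : {perm T},
    [/\ forall i, i < n -> p (v i) = v (n.-1 - i),
        forall x, (forall i, i < n -> x <> v i) -> p x = x
      & odd_perm p = odd n./2].
Proof.
have [m] := ubnP n; elim: m n v => // m IHm [|[|n]] v ltnm injv.
- by exists 1%g; split=> [i|x _|] //; rewrite ?perm1 ?odd_perm1.
- exists 1%g; split=> [[|i]|x _|] //; by rewrite ?perm1 ?odd_perm1.
have eqv i j : i < n.+2 -> j < n.+2 -> v i = v j -> i = j.
  by move=> lti ltj; apply: injv.
have [||p [p_v p_fix p_odd]] := IHm n (fun i => v i.+1); first by lia.
  by move=> i j; rewrite !inE => lti ltj /eqv; lia.
have p0 : p (v 0) = v 0.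
  by apply: p_fix => i lti /eqv; lia.
have pn : p (v n.+1) = v n.+1.
  by apply: p_fix => i lti /eqv; lia.
exists (p * tperm (v 0) (v n.+1))%g; split=> [i lti|x x_v|].
- rewrite permM; case: i lti => [|i] lti; first by rewrite p0 tpermL subn0.
  have [->|ltin] : i = n \/ i < n by lia.
    by rewrite pn tpermR subnn.
  rewrite p_v // tpermD; last 2 first.
  + by apply/eqP => /eqv; lia.
  + by apply/eqP => /eqv; lia.
  by congr v; rewrite /=; lia.
- rewrite permM p_fix; last by move=> i lti; apply: x_v; lia.
  by rewrite tpermD // eq_sym; apply/eqP; apply: x_v.
- rewrite odd_permM p_odd odd_tperm.
  have -> : v 0 != v n.+1 by apply/eqP => /eqv; lia.
  by rewrite /= addbT.
Qed.

Fixpoint alt_walk {T : Type} (a b : T -> T) (x : T) (n : nat) : T :=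
  if n is m.+1 then (if odd m then b else a) (alt_walk a b x m) else x.

Section AlternatingWalk.

Variables (T : finType) (a b : T -> T) (x0 : T).
Hypotheses (aK : involutive a) (bK : involutive b).
Hypotheses (a_fpf : forall x, a x <> x) (b_fpf : forall x, b x <> x).

Let v := alt_walk a b x0.

Lemma alt_walk_even n : ~~ odd n -> a (v n) = v n.+1.
Proof. by rewrite /v /= => /negbTE ->. Qed.

Lemma alt_walk_odd n : odd n -> b (v n) = v n.+1.
Proof. by rewrite /v /= => ->. Qed.

(* Walk towards each other from both ends until two adjacent points coincide. *)
Lemma alt_walk_parity i d : v i <> v (i + d.*2.+1).
Proof.
elim: d i => [|d IHd] i e.
  move: e; rewrite addn1 /v /=; case: ifP => _ e.
    by apply: (b_fpf (v i)); rewrite /v -e.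
  by apply: (a_fpf (v i)); rewrite /v -e.
apply: (IHd i.+1); have -> : i.+1 + d.*2.+1 = i + d.*2.+2 by lia.
move: e; have -> : i + d.+1.*2.+1 = (i + d.*2.+2).+1 by lia.
have odd_eq : odd (i + d.*2.+2) = odd i by lia.
by rewrite /v /= odd_eq; case: (odd i) => ->; rewrite ?aK ?bK.
Qed.

(** Points at even distance are reached by the same involution, which is injective, so an equality
    between them can be moved back step by step to the start. *)
Lemma alt_walk_shift i d : v i = v (i + d.*2) -> v d.*2 = x0.
Proof.
elim: i => [|i IHi] e; first by rewrite -[d.*2]add0n -e.
apply: IHi; move: e; rewrite addSn /v /=.
have -> : odd (i + d.*2) = odd i by lia.
by case: (odd i) => [/(inv_inj bK)|/(inv_inj aK)].
Qed.

(** The even positions run through the orbit of [x0] under [a] followed by [b]; [l] is the first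
    return. An earlier coincidence is at odd distance, excluded by parity, or at even distance,
    forcing a return before [l]. *)
Lemma alt_walk_closed :
  exists2 l, 0 < l & v l.*2 = x0 /\ {in gtn l.*2 &, injective v}.
Proof.
pose c x := b (a x).
have cI : injective c by apply: inj_comp; apply: inv_inj.
have vE i : v i.*2 = iter i c x0.
  by elim: i => // i IHi; rewrite doubleS /v /= odd_double /= -/v IHi.
have ex_l : exists l, (0 < l) && (v l.*2 == x0).
  exists (fingraph.order c x0); rewrite fingraph.order_gt0 vE.
  by rewrite iter_order ?eqxx.
have [l /andP[l_gt0 /eqP vl] l_min] := ex_minnP ex_l.
exists l => //; split=> //.
have lt_neq i j : i < j -> j < l.*2 -> v i <> v j.
  move=> ltij ltj; have [d dE] : exists d, j = i + d.*2 \/ j = i + d.*2.+1.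
    by exists ((j - i)./2); lia.
  case: dE => dE; rewrite dE; last exact: alt_walk_parity.
  move=> /alt_walk_shift vd.
  have := l_min d; rewrite vd eqxx andbT; lia.
move=> i j; rewrite !inE => lti ltj e.
by case: (ltngtP i j) => // lt_ij; [case: (lt_neq i j) | case: (lt_neq j i)].
Qed.

End AlternatingWalk.

(* [alpha] and [beta] send a point to its edge in the matchings [a] and [b]. *)
Lemma alternating_reflection (T U V : finType) (a b : T -> T)
    (alpha : T -> U) (beta : T -> V) (x0 : T) :
    involutive a -> involutive b ->
    (forall x, a x <> x) -> (forall x, b x <> x) ->
    (forall x y, alpha x = alpha y <-> x = y \/ x = a y) ->
    (forall x y, beta x = beta y <-> x = y \/ x = b y) ->
  exists (r : {perm T}) (p : {perm U}) (q : {perm V}),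
    [/\ forall x, alpha (r x) = p (alpha x),
        forall x, beta (r x) = q (beta x)
      & odd_perm r (+) odd_perm p (+) odd_perm q].
Proof.
move=> aK bK a_fpf b_fpf alphaP betaP.
have [l l_gt0 [vl injv]] := alt_walk_closed T a b x0 aK bK a_fpf b_fpf.
pose v := alt_walk a b x0.
have eqv i j : i < l.*2 -> j < l.*2 -> v i = v j -> i = j.
  by move=> lti ltj; apply: injv.
have av i : a (v i.*2) = v i.*2.+1 by apply: alt_walk_even; rewrite odd_double.
have bv i : b (v i.*2.+1) = v i.*2.+2.
  by apply: alt_walk_odd; rewrite /= odd_double.
have alphav i : alpha (v i.*2.+1) = alpha (v i.*2).
  by apply/alphaP; right; rewrite av.
have betav i : beta (v i.*2.+2) = beta (v i.*2.+1).
  by apply/betaP; right; rewrite bv.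
have beta_end : beta (v l.*2.-1) = beta (v 0).
  have -> : l.*2.-1 = l.-1.*2.+1 by lia.
  by rewrite -betav; congr (beta _); rewrite -[RHS]vl; congr v; lia.
have [r [r_v r_fix r_odd]] := reversal_perm T l.*2 v injv.
(* The [i]-th [a]-edge joins [v i.*2] and [v i.*2.+1]; reversing the cycle sends it to the edge of
   index [l.-1 - i]. *)
have [|p [p_v p_fix p_odd]] := reversal_perm U l (fun i => alpha (v i.*2)).
  by move=> i j; rewrite !inE => lti ltj /alphaP[|]; rewrite ?av => /eqv; lia.
(* The [b]-edge joining [v l.*2.-1] to [v 0] is mapped to itself, so only the other [l.-1] edges are
   reversed. *)
have [|q [q_v q_fix q_odd]] :=
    reversal_perm V l.-1 (fun i => beta (v i.*2.+1)).
  by move=> i j; rewrite !inE => lti ltj /betaP[|]; rewrite ?bv => /eqv; lia.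
(* There are [l] swaps of points, and [l./2] and [l.-1./2] swaps of edges; the last two add up to
   [l.-1], so the total is odd. *)
exists r, p, q; split; last by rewrite r_odd p_odd q_odd; lia.
- move=> x; have [/existsP[m /eqP xE]|x_v] :=
    boolP [exists m : 'I_l.*2, x == v m].
    have := ltn_ord m; rewrite xE; move: (m : nat) => {x m xE} n ltn.
    rewrite r_v // -[in RHS](odd_double_half n).
    case: (odd n) (odd_double_half n).
    + move=> nE; rewrite add1n alphav p_v; last lia.
      by congr (alpha (v _)); lia.
    + move=> nE; rewrite add0n p_v; last lia.
      by rewrite -alphav; congr (alpha (v _)); lia.
  have x_nv i : i < l.*2 -> x <> v i.
    move=> lti xE; case/existsP: x_v.
    by exists (Ordinal lti); rewrite xE.
  rewrite r_fix // p_fix // => i lti /alphaP[|]; rewrite ?av; apply: x_nv; lia.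
- have q_end : q (beta (v 0)) = beta (v 0).
    by apply: q_fix => i lti /betaP[|]; rewrite ?bv => /eqv; lia.
  move=> x; have [/existsP[m /eqP xE]|x_v] :=
    boolP [exists m : 'I_l.*2, x == v m].
    have := ltn_ord m; rewrite xE; move: (m : nat) => {x m xE} n ltn.
    rewrite r_v //; case: n ltn => [|n] ltn; first by rewrite subn0 beta_end.
    have [->|ltn'] : n.+1 = l.*2.-1 \/ n.+1 < l.*2.-1 by lia.
      by rewrite beta_end subnn.
    rewrite -[in RHS](odd_double_half n).
    case: (odd n) (odd_double_half n).
    + move=> nE; rewrite add1n betav q_v; last lia.
      by congr (beta (v _)); lia.
    + move=> nE; rewrite add0n q_v; last lia.
      by rewrite -betav; congr (beta (v _)); lia.
  have x_nv i : i < l.*2 -> x <> v i.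
    move=> lti xE; case/existsP: x_v.
    by exists (Ordinal lti); rewrite xE.
  rewrite r_fix // q_fix // => i lti /betaP[|]; rewrite ?bv; apply: x_nv; lia.
Qed.

Definition partner (k : nat) (x : 'I_(2 * k)) : 'I_(2 * k) :=
  pt (blk x) (~~ odd x).

Lemma partnerK (k : nat) : involutive (partner k).
Proof. by move=> x; rewrite /partner blk_pt odd_pt negbK pt_blk. Qed.

Lemma partner_neq (k : nat) (x : 'I_(2 * k)) : partner k x <> x.
Proof.
move=> /(congr1 (fun y : 'I_(2 * k) => odd y)); rewrite odd_pt.
by case: (odd x).
Qed.

Lemma blk_eqP (k : nat) (x y : 'I_(2 * k)) :
  blk x = blk y <-> x = y \/ x = partner k y.
Proof.
split=> [e|[->|->]] //; last by rewrite blk_pt.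
rewrite -(pt_blk x) e /partner -{2}(pt_blk y).
by case: (odd x) (odd y) => -[]; [left|right|right|left].
Qed.

(** [bar] is multiplicative and turns a transposition into a product of two, one on each parity
    class. *)
Lemma even_bar (k : nat) (g : 'S_k) : odd_perm (bar g) = false.
Proof.
have barM (s t : 'S_k) : bar (s * t) = (bar s * bar t)%g.
  by apply/permP => x; rewrite -(pt_blk x) permM !bar_pt permM.
have [ts -> _] := prod_tpermP g.
elim: ts => [|[i j] ts IHts].
  rewrite big_nil; suff -> : bar (1 : 'S_k)%g = 1%g by rewrite odd_perm1.
  by apply/permP => x; rewrite -(pt_blk x) bar_pt !perm1.
rewrite big_cons barM odd_permM IHts addbF /=.
have pt_eq (s t : 'I_k) c d : (pt s c == pt t d) = (s == t) && (c == d).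
  apply/eqP/andP => [e|[/eqP-> /eqP->]] //; split; apply/eqP.
    by rewrite -(blk_pt s c) e blk_pt.
  by rewrite -(odd_pt s c) e odd_pt.
have pt_inj c : injective (fun s : 'I_k => pt s c).
  by move=> s t /eqP; rewrite pt_eq => /andP[/eqP].
have -> : bar (tperm i j) =
    (tperm (pt i false) (pt j false) * tperm (pt i true) (pt j true))%g.
  apply/permP => x; rewrite -(pt_blk x) permM bar_pt.
  rewrite (inj_tperm _ _ _ (pt_inj (odd x))).
  case: (odd x); first by rewrite [tperm (pt i false) _ _]tpermD ?pt_eq ?andbF.
  by rewrite -(inj_tperm _ _ _ (pt_inj false)) [RHS]tpermD ?pt_eq ?andbF.
by rewrite odd_permM !odd_tperm !pt_eq !andbT addbb.
Qed.

(** Such a [t] fixes or swaps the two points of each block. Multiplying by the generator of a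
    swapped block undoes that swap and creates no new one, so induct on the number of swapped
    blocks. *)
Lemma mem_subgroupK (k : nat) (t : 'S_(2 * k)) :
  (forall x, blk (t x) = blk x) -> t \in subgroupK k.
Proof.
have [m] := ubnP #|[set s : 'I_k | t (pt s false) != pt s false]|.
elim: m t => // m IHm t lem t_blk.
have pt_or s c : t (pt s c) = pt s c \/ t (pt s c) = pt s (~~ c).
  have /blk_eqP := t_blk (pt s c).
  by rewrite /partner blk_pt odd_pt.
have [/eqP/setP t0|/set0Pn[s]] :=
    boolP ([set s : 'I_k | t (pt s false) != pt s false] == set0).
  suff -> : t = 1%g by apply: group1.
  have fixf s : t (pt s false) = pt s false.
    by apply/eqP; have := t0 s; rewrite !inE => /negbFE.
  apply/permP => x; rewrite perm1 -(pt_blk x); case: (odd x) => //.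
  case: (pt_or (blk x) true) => //= e.
  by rewrite (perm_inj (etrans e (esym (fixf (blk x))))) fixf.
rewrite inE => ts.
have tsf : t (pt s false) = pt s true.
  by case: (pt_or s false) => // e; rewrite e eqxx in ts.
pose u := tperm (pt s false) (pt s true).
have u_K : u \in subgroupK k by apply/mem_gen/imset_f.
have u_blk x : blk (u x) = blk x.
  by rewrite /u; case: tpermP => [->|->|]; rewrite ?blk_pt.
rewrite -(groupMr _ u_K); apply: IHm => [|x]; last by rewrite permM u_blk.
rewrite -ltnS; apply: leq_trans lem; rewrite ltnS.
apply/proper_card/properP; split.
  apply/subsetP => s'; rewrite !inE; apply: contra => /eqP e.
  have ne : s' != s by apply: contraNneq ts => <-; rewrite e.
  have ne' c : pt s c != pt s' false.
    by apply: contraNneq ne => /(congr1 (@blk k)); rewrite !blk_pt => ->.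
  by rewrite permM e tpermD.
by exists s; rewrite !inE ?ts // permM tsf tpermR eqxx.
Qed.

Theorem mainTheorem3 (k : nat) (hk : 1 <= k) (sigma : 'S_(2 * k)) :
  exists (tau tau1 : 'S_(2 * k)) (g g1 : 'S_k),
    [/\ tau \in subgroupK k,
        tau1 \in subgroupK k,
        sigma \o tau \o bar g \o (sigma^-1)%g =1 tau1 \o bar g1
      & (sgn tau1 * sgn g * sgn g1)%R = (-1)%R].
Proof.
(* The partner involution of [M1], whose edges are labelled by the block of the preimage under
   [sigma]. *)
pose b x := sigma (partner k ((sigma^-1)%g x)).
have bK : involutive b by move=> x; rewrite /b permK partnerK permKV.
have b_fpf x : b x <> x.
  by move=> /(congr1 (sigma^-1)%g); rewrite permK; apply: partner_neq.
have betaP x y : blk ((sigma^-1)%g x) = blk ((sigma^-1)%g y) <->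
    x = y \/ x = b y.
  rewrite blk_eqP; split=> -[]; last 1 first.
  - by move=> ->; right; rewrite /b permK.
  - by move/perm_inj => ->; left.
  - by move=> e; right; rewrite /b -e permKV.
  - by move=> ->; left.
(* [g1] is the action of [r] on [M0] and [g] its action on [M1]; [hk] supplies a starting point. *)
have [r [g1 [g [r_g1 r_g r_odd]]]] :=
  alternating_reflection _ _ _ (partner k) b (@blk k)
    (fun x => blk ((sigma^-1)%g x)) (pt (Ordinal hk) false)
    (partnerK k) bK (partner_neq k) b_fpf (blk_eqP k) betaP.
have blk_bar (h : 'S_k) x : blk (bar h x) = h (blk x).
  by rewrite -(pt_blk x) bar_pt !blk_pt.
(* Products apply their left factor first, so both sides of (i) become [r]. *)
exists ((bar g)^-1 * (sigma * r * sigma^-1))%g, ((bar g1)^-1 * r)%g, g, g1.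
split.
- apply: mem_subgroupK => x; rewrite -{2}(permKV (bar g) x).
  by rewrite blk_bar !permM r_g permK.
- apply: mem_subgroupK => x; rewrite -{2}(permKV (bar g1) x).
  by rewrite blk_bar permM r_g1.
- by move=> x; rewrite /= !permM !permK !permKV.
(* As [bar g1] is even, [tau1] has the sign of [r]. *)
- rewrite /sgn odd_permM odd_permV even_bar /= -!GRing.signr_addb.
  by rewrite addbAC r_odd.
Qed.
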